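(* Let the $1$-jet space $J^1(\mathbb{R},M^4)$ be endowed with the relativistic rheonomic Berwald-Moór metric $\mathring F(t,y)=\sqrt{h^{11}(t)}\,\sqrt[4]{y_1^1y_1^2y_1^3y_1^4}$, and consider on it a non-isotropic plasma with hydrostatic pressure $\mathbf p(t,x,y)$, proper mass density $\boldsymbol\rho(t,x,y)$, horizontal Lorentz force $\overset{h}{\mathcal F}{}^{k}$ and vertical Lorentz d-tensor force $\overset{v}{\mathcal F}{}^{k1}$. Let $c(t)=(x^k(t))$ be a curve in $M^4$, let $y_1^k=dx^k/dt$, and let $s$ be the natural parameter of the curve, $ds/dt=\mathring F(t,dx/dt)$. Then for the Berwald-Moór metric the (horizontal and vertical) non-isotropic stream line differential equations of the plasma become the following, for each fixed $k\in\{1,2,3,4\}$ (sum over $m$ from $1$ to $4$, no sum over $k$): (i) the horizontal non-isotropic stream line equations are equivalent to $$\frac{d^2x^k}{ds^2}+\frac{c^2}{\mathbf p+\boldsymbol\rho c^2}\,\frac{\delta \mathbf p}{\delta x^m}\,(1-4\delta^{km})\,\frac{dx^m}{ds}\frac{dx^k}{ds}=\frac{h_{11}c^2}{\mathbf p+\boldsymbol\rho c^2}\,\overset{h}{\mathcal F}{}^{k};$$ (ii) the vertical non-isotropic stream line equations are equivalent to $$\frac{\partial \mathbf p}{\partial y_1^m}\,(1-4\delta^{mk})\,\frac{dx^m}{ds}\frac{dx^k}{ds}=h_{11}\,\overset{v}{\mathcal F}{}^{k1}.$$ Here all coefficients are evaluated at $(t,x(t),dx/dt)$.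
   Context: Latin indices run from $1$ to $4$, and repeated indices are summed unless stated otherwise; $\delta^{km}$, $\delta_{ij}$, $\delta^k_r$ are Kronecker symbols. The speed of light $c>0$ is a constant. Setting. $h_{11}(t)>0$ is a Riemannian metric on $\mathbb{R}$, $h^{11}=1/h_{11}$, and $\varkappa_{11}^1=\frac{h^{11}}{2}\frac{dh_{11}}{dt}$. $M^4$ is a real $4$-manifold with local coordinates $(x^i)$, and $J^1(\mathbb{R},M^4)$ has local coordinates $(t,x^i,y_1^i)$. One works on the domain $y_1^1y_1^2y_1^3y_1^4>0$ and assumes $\mathbf p+\boldsymbol\rho c^2\neq 0$. All functions are smooth. Metric. $g_{ij}=\frac{h_{11}}{2}\frac{\partial^2\mathring F^2}{\partial y_1^i\partial y_1^j}$, with inverse matrix $(g^{ij})$. (For this metric, with $G_{1111}=y_1^1y_1^2y_1^3y_1^4$, one has, without summation, $g_{ij}=\frac{(1-2\delta_{ij})\sqrt{G_{1111}}}{8\,y_1^iy_1^j}$ and $g^{jk}=\frac{2(1-2\delta^{jk})}{\sqrt{G_{1111}}}y_1^jy_1^k$.) Adapted derivative and Cartan connection. The canonical nonlinear connection of $\mathring F$ has spatial components $N_{(1)j}^{(i)}=-\frac{\varkappa_{11}^1}{3}\delta_j^i$, so that $$\frac{\delta}{\delta x^i}=\frac{\partial}{\partial x^i}+\frac{\varkappa_{11}^1}{3}\frac{\partial}{\partial y_1^i}.$$ The Cartan connection coefficients are $$L_{jk}^i=\frac{g^{im}}{2}\Big(\frac{\delta g_{jm}}{\delta x^k}+\frac{\delta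 g_{km}}{\delta x^j}-\frac{\delta g_{jk}}{\delta x^m}\Big),\qquad C_{j(k)}^{i(1)}=\frac{g^{im}}{2}\Big(\frac{\partial g_{jm}}{\partial y_1^k}+\frac{\partial g_{km}}{\partial y_1^j}-\frac{\partial g_{jk}}{\partial y_1^m}\Big).$$ For a d-tensor $E^m_s$, the horizontal and vertical covariant derivatives are $E^m_{s|p}=\frac{\delta E^m_s}{\delta x^p}+E^r_sL^m_{rp}-E^m_rL^r_{sp}$ and $E^m_s|^{(1)}_{(p)}=\frac{\partial E^m_s}{\partial y_1^p}+E^r_sC^{m(1)}_{r(p)}-E^m_rC^{r(1)}_{s(p)}$. Lorentz forces. Let $H=H_{ij}(t,x,y)\,dx^i\wedge dx^j$ and $G=G_{ij}(t,x,y)\,dx^i\wedge dx^j$ be the distinguished $2$-forms of the (electric field)-(magnetic induction) and of the (electric induction)-(magnetic field). The Minkowski energy d-tensor is $E_{ij}=\frac14 g_{ij}H_{rs}G^{rs}+g^{rs}H_{ir}G_{js}$, where $G^{rs}=g^{rp}g^{sq}G_{pq}$, and $E_i^m=g^{mp}E_{pi}$. With $u_1^i=y_1^i/\mathring F$, it is assumed to satisfy the non-isotropic Lorentz conditions $E^m_{i|m}u_1^i=0$ and $E^m_i|^{(1)}_{(m)}u_1^i=0$. The Lorentz forces are $$\overset{h}{\mathcal F}{}^{r}=-g^{rs}E^m_{s|m},\qquad \overset{v}{\mathcal F}{}^{r1}=-g^{rs}E^m_s|^{(1)}_{(m)}.$$ Stream line equations. For a jet Finsler metric $F$ that does not depend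 on $x$ (a jet Minkowski-like metric), the non-isotropic stream line equations of plasma, along a curve $x(t)$ with $y_1^k=dx^k/dt$ and $ds/dt=F$, are: - horizontal: $$\frac{d^2x^k}{ds^2}+\Big[L_{rm}^k-\frac{c^2}{\mathbf p+\boldsymbol\rho c^2}\delta_r^k\frac{\delta\mathbf p}{\delta x^m}\Big]\frac{dx^r}{ds}\frac{dx^m}{ds}=\frac{h_{11}c^2}{\mathbf p+\boldsymbol\rho c^2}\Big[\overset{h}{\mathcal F}{}^{k}-g^{km}\frac{\delta\mathbf p}{\delta x^m}\Big];$$ - vertical: $$\frac{\partial\mathbf p}{\partial y_1^m}\Big[h_{11}g^{mk}-\frac{dx^m}{ds}\frac{dx^k}{ds}\Big]=h_{11}\,\overset{v}{\mathcal F}{}^{k1}.$$ *)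

(* Defs.v *)
(* Jet geometry of plasma stream lines on J^1(R, M^4), in a coordinate chart of
   M^4 whose image is an open set of R^4, over MathComp-Analysis. *)
From HB Require Import structures.
From mathcomp Require Import all_boot all_order all_algebra.
From mathcomp Require Import all_classical all_reals all_analysis.

Set Implicit Arguments.
Unset Strict Implicit.
Unset Printing Implicit Defensive.

Import Order.TTheory GRing.Theory Num.Theory.
Import numFieldNormedType.Exports.

Local Open Scope classical_set_scope.
Local Open Scope ring_scope.

(* On an open set D of a finite-dimensional space this is membership in C^n:
   f is continuous and every directional derivative exists and is C^(n-1). *)
Fixpoint Cn_on (R : realType) (V : normedModType R) (n : nat)
    (D : set V) (f : V -> R) : Prop :=
  (forall z, D z -> {for z, continuous f}) /\
  match n with
  | 0%N => True
  | n'.+1 => forall v : V,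
      (forall z, D z -> derivable f z v) /\ Cn_on n' D (fun z => 'D_v f z)
  end.

Definition smooth_on (R : realType) (V : normedModType R)
    (D : set V) (f : V -> R) : Prop := forall n, Cn_on n D f.

(* Functions of the jet coordinates (t, x, y), and matrices of such functions.
   Indices 1..4 are represented by 'I_4 = {0,..,3}. *)
Definition jetfun (R : realType) := R -> 'rV[R]_4 -> 'rV[R]_4 -> R.
Definition jetmx (R : realType) := R -> 'rV[R]_4 -> 'rV[R]_4 -> 'M[R]_4.

(* The part of the jet chart over the coordinate domain U on which
   y^1 y^2 y^3 y^4 > 0. *)
Definition jet_dom (R : realType) (U : set 'rV[R]_4) :
    set (R * 'rV[R]_4 * 'rV[R]_4)%type :=
  [set z : (R * 'rV[R]_4 * 'rV[R]_4)%type |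
    U z.1.2 /\ 0 < \prod_(i < 4) z.2 0 i].

Definition jet_smooth (R : realType) (U : set 'rV[R]_4) (f : jetfun R) : Prop :=
  smooth_on (jet_dom U)
    (fun z : (R * 'rV[R]_4 * 'rV[R]_4)%type => f z.1.1 z.1.2 z.2).

Definition jet_partial_x (R : realType) (i : 'I_4) (f : jetfun R) : jetfun R :=
  fun t x y => 'D_(delta_mx 0 i) (fun x' : 'rV[R]_4 => f t x' y) x.

Definition jet_partial_y (R : realType) (i : 'I_4) (f : jetfun R) : jetfun R :=
  fun t x y => 'D_(delta_mx 0 i) (fun y' : 'rV[R]_4 => f t x y') y.

(* varkappa = (h^11 / 2) dh_11/dt *)
Definition varkappa (R : realType) (h11 : R -> R) (t : R) : R :=
  (h11 t)^-1 / 2 * derive1 h11 t.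

(* The fundamental objects of a jet metric F(t, y) not depending on x, with
   nonlinear connection N, where N t x y i j = N^(i)_(1)j. *)
Section JetMinkowskiGeometry.

Context {R : realType} (h11 : R -> R).
Context (F : R -> 'rV[R]_4 -> R) (N : jetmx R).

Definition g_low : jetmx R := fun t x y =>
  \matrix_(i, j) (h11 t / 2 *
    jet_partial_y i (jet_partial_y j (fun t' _ y' => F t' y' ^+ 2)) t x y).

Definition g_up : jetmx R := fun t x y => invmx (g_low t x y).

(* delta f / delta x^i *)
Definition delta_x (i : 'I_4) (f : jetfun R) : jetfun R := fun t x y =>
  jet_partial_x i f t x y - \sum_j N t x y j i * jet_partial_y j f t x y.

(* L^i_jk *)
Definition cartan_L (i j k : 'I_4) : jetfun R := fun t x y =>
  \sum_m g_up t x y i m / 2 *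
    (delta_x k (fun t x y => g_low t x y j m) t x y
     + delta_x j (fun t x y => g_low t x y k m) t x y
     - delta_x m (fun t x y => g_low t x y j k) t x y).

(* C^i(1)_j(k) *)
Definition cartan_C (i j k : 'I_4) : jetfun R := fun t x y =>
  \sum_m g_up t x y i m / 2 *
    (jet_partial_y k (fun t x y => g_low t x y j m) t x y
     + jet_partial_y j (fun t x y => g_low t x y k m) t x y
     - jet_partial_y m (fun t x y => g_low t x y j k) t x y).

(* Covariant derivatives of a (1,1) d-tensor E, where E t x y m s = E^m_s:
   hcov E m s p = E^m_(s|p) and vcov E m s p = E^m_s|^(1)_(p). *)
Definition hcov (E : jetmx R) (m s p : 'I_4) : jetfun R := fun t x y =>
  delta_x p (fun t x y => E t x y m s) t x y
  + \sum_r E t x y r s * cartan_L m r p t x y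
  - \sum_r E t x y m r * cartan_L r s p t x y.

Definition vcov (E : jetmx R) (m s p : 'I_4) : jetfun R := fun t x y =>
  jet_partial_y p (fun t x y => E t x y m s) t x y
  + \sum_r E t x y r s * cartan_C m r p t x y
  - \sum_r E t x y m r * cartan_C r s p t x y.

Section Electromagnetism.

(* H t x y i j = H_ij and G t x y i j = G_ij *)
Context (H G : jetmx R).

Definition G_up : jetmx R := fun t x y => \matrix_(r, s)
  \sum_p \sum_q g_up t x y r p * g_up t x y s q * G t x y p q.

Definition minkowski_low : jetmx R := fun t x y => \matrix_(i, j)
  (4^-1 * g_low t x y i j * (\sum_r \sum_s H t x y r s * G_up t x y r s)
   + \sum_r \sum_s g_up t x y r s * H t x y i r * G t x y j s).

(* Entry (m, i) is E^m_i = g^mp E_pi. *)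
Definition minkowski_energy : jetmx R := fun t x y => \matrix_(m, i)
  \sum_p g_up t x y m p * minkowski_low t x y p i.

Definition lorentz_conditions (U : set 'rV[R]_4) : Prop :=
  forall t x y, jet_dom U (t, x, y) ->
    \sum_i \sum_m hcov minkowski_energy m i m t x y * (y 0 i / F t y) = 0 /\
    \sum_i \sum_m vcov minkowski_energy m i m t x y * (y 0 i / F t y) = 0.

Definition lorentz_force_h (r : 'I_4) : jetfun R := fun t x y =>
  - \sum_s g_up t x y r s * \sum_m hcov minkowski_energy m s m t x y.

Definition lorentz_force_v (r : 'I_4) : jetfun R := fun t x y =>
  - \sum_s g_up t x y r s * \sum_m vcov minkowski_energy m s m t x y.

End Electromagnetism.

End JetMinkowskiGeometry.

Section Curves.

Context {R : realType}.

(* dx/dt *)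
Definition velocity (x : R -> 'rV[R]_4) (t : R) : 'rV[R]_4 :=
  \row_k derive1 (fun u => x u 0 k) t.

Definition regular_curve (U : set 'rV[R]_4) (I : set R)
    (x : R -> 'rV[R]_4) : Prop :=
  [/\ open I, is_interval I,
      forall k, smooth_on I (fun t : R => x t 0 k) &
      forall t, I t -> jet_dom U (t, x t, velocity x t)].

(* s is a natural parameter of the curve x on I; tau is the inverse function
   t = tau(s), so that s |-> x (tau s) is the curve in terms of s. *)
Definition natural_parameter (F : R -> 'rV[R]_4 -> R) (I : set R)
    (x : R -> 'rV[R]_4) (s tau : R -> R) : Prop :=
  forall t, I t -> is_derive t 1 s (F t (velocity x t)) /\ tau (s t) = t.

(* d^n x^k / ds^n at the point of parameter t *)
Definition dn_ds (n : nat) (x : R -> 'rV[R]_4) (s tau : R -> R) (k : 'I_4)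
    (t : R) : R :=
  derive1n n (fun sigma => x (tau sigma) 0 k) (s t).

End Curves.

Section StreamLines.

Context {R : realType} (h11 : R -> R) (c : R).
Context (F : R -> 'rV[R]_4 -> R) (N : jetmx R).
Context (p rho : jetfun R) (H G : jetmx R).
Context (x : R -> 'rV[R]_4) (s tau : R -> R).

Definition horizontal_stream_line (k : 'I_4) (t : R) : Prop :=
  let X := x t in
  let Y := velocity x t in
  let w := p t X Y + rho t X Y * c ^+ 2 in
  dn_ds 2 x s tau k t
  + \sum_r \sum_m
      (cartan_L h11 F N k r m t X Y
       - c ^+ 2 / w * (k == r)%:R * delta_x N m p t X Y)
      * dn_ds 1 x s tau r t * dn_ds 1 x s tau m t
  = h11 t * c ^+ 2 / w *
    (lorentz_force_h h11 F N H G k t X Y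
     - \sum_m g_up h11 F t X Y k m * delta_x N m p t X Y).

Definition vertical_stream_line (k : 'I_4) (t : R) : Prop :=
  let X := x t in
  let Y := velocity x t in
  \sum_m jet_partial_y m p t X Y *
    (h11 t * g_up h11 F t X Y m k - dn_ds 1 x s tau m t * dn_ds 1 x s tau k t)
  = h11 t * lorentz_force_v h11 F H G k t X Y.

End StreamLines.

Section BerwaldMoor.

Context {R : realType} (h11 : R -> R).

Definition berwald_moor (t : R) (y : 'rV[R]_4) : R :=
  Num.sqrt (h11 t)^-1 * (\prod_(i < 4) y 0 i) `^ 4^-1.

(* The canonical nonlinear connection of the Berwald-Moor metric; with it,
   delta_x i is d/dx^i + (varkappa / 3) d/dy^i. *)
Definition berwald_moor_N : jetmx R := fun t _ _ =>
  \matrix_(i, j) (- (varkappa h11 t / 3) * (i == j)%:R).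

End BerwaldMoor.

(* Main.v *)
Require Import Defs.
From HB Require Import structures.
From mathcomp Require Import all_boot all_order all_algebra.
From mathcomp Require Import all_classical all_reals all_analysis.
From mathcomp Require Import ring.
Import Order.TTheory GRing.Theory Num.Theory.
Import numFieldNormedType.Exports.
Local Open Scope classical_set_scope.
Local Open Scope ring_scope.

(** Two facts reduce the stream line equations to the stated ones. On the
    domain where W = y1 y2 y3 y4 is positive, F^2 = h^11 sqrt(W), whence
    g_ij = (1 - 2 delta_ij) sqrt(W) / (8 y_i y_j), and the inverse metric
    satisfies h11 g^ij = 2 (1 - 2 delta_ij) (y^i / F) (y^j / F)
    ([h11_g_upE]). Along the curve dx^i/ds = y^i / F
    ([velocity_natural_parameter]), so
    h11 g^km - (dx^k/ds) (dx^m/ds) = (1 - 4 delta_km) (dx^k/ds) (dx^m/ds).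
    This settles the vertical equation, and the pressure terms of the
    horizontal one. Second, the connection term L^k_rm (dx^r/ds) (dx^m/ds)
    vanishes ([cartan_L_contraction0]), because L is built from y-derivatives
    of a metric that is homogeneous of degree 0 in y. The second derivative
    d^2x^k/ds^2 and the Lorentz forces are the same on both sides and remain
    untouched.

    The derivatives are all instances of one rule: the functions
    sqrt(W) / (y_i y_j ...), indexed by lists of indices, are carried to
    multiples of one another by the partial derivatives
    ([derive_sqrt_mono]). *)

(** * Derivatives along coordinate lines *)

Section DirectionalDerivatives.
Context {R : realType}.

(** The difference quotient of a directional derivative is that of the
    restriction to the line, so the one-variable rules for square roots and
    inverses become available for functions of a vector. *)
Lemma is_derive_along_line (V : normedModType R) (f : V -> R) (a v : V) (d : R) :
  is_derive (0 : R) 1 (fun h : R => f (h *: v + a)) d -> is_derive a v f d.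
Proof.
have quotientE :
    (fun h : R => h^-1 *: ((f \o shift a) (h *: v) - f a)) =
    (fun h : R => h^-1 *: (((fun u : R => f (u *: v + a)) \o shift (0 : R))
                             (h *: (1 : R)) - f (0 *: v + a))).
  by apply/funext => h /=; rewrite addr0 [h *: 1]mulr1 scale0r add0r.
move=> [lim_ex lim_val]; apply: DeriveDef.
- by rewrite /derivable quotientE.
- by rewrite /derive quotientE.
Qed.

Lemma is_derive_affine (a b x : R) : is_derive x 1 (fun h : R => h * a + b) a.
Proof.
have -> : (fun h : R => h * a + b) = (a \*: (@id R) + cst b : R -> R).
  by apply/funext => h /=; rewrite mulrC.
by apply: is_derive_eq; rewrite addr0 [a *: 1]mulr1.
Qed.

End DirectionalDerivatives.

(** * Monomials sqrt(y1 y2 y3 y4) / (y_i y_j ...) *)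

Section Monomials.
Context {R : realType}.
Implicit Types (y : 'rV[R]_4) (i j k : 'I_4) (l : seq 'I_4).

Definition coord_prod y : R := \prod_(i < 4) y 0 i.

(** Repeated indices in [l] stand for powers. Up to constants, this family
    contains F^2 and g_ij, and it is stable under partial differentiation. *)
Definition sqrt_mono l y : R :=
  Num.sqrt (coord_prod y) * \prod_(j <- l) (y 0 j)^-1.

Lemma coord_neq0 y i : 0 < coord_prod y -> y 0 i != 0.
Proof. by move=> /lt0r_neq0 /prodf_neq0 /(_ i isT). Qed.

Lemma open_coord_prod_gt0 : open [set y | 0 < coord_prod y].
Proof.
apply: (@open_comp _ _ coord_prod [set r : R | 0 < r]); last exact: open_gt.
move=> y _.
have -> : coord_prod = \prod_(i < 4) (fun y : 'rV[R]_4 => y 0 i).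
  by rewrite fct_prodE.
elim/big_ind: _ => [|f g fc gc|i _]; first exact: cst_continuous.
- exact: continuousM.
- exact: coord_continuous.
Qed.

Lemma coord_line y i j (h : R) :
  (h *: delta_mx 0 i + y : 'rV[R]_4) 0 j = h * (j == i)%:R + y 0 j.
Proof. by rewrite !mxE. Qed.

(** The product is affine in each coordinate separately. *)
Lemma coord_prod_line y i (h : R) : y 0 i != 0 ->
  coord_prod (h *: delta_mx 0 i + y) = coord_prod y * (h * (y 0 i)^-1 + 1).
Proof.
move=> yi; rewrite /coord_prod (bigD1 i) //= [in RHS](bigD1 i) //=.
rewrite coord_line eqxx (eq_bigr (fun j => y 0 j)); last first.
  by move=> j /negPf ji; rewrite coord_line ji mulr0 add0r.
by rewrite mulr1; field.
Qed.

(** The exponent of [y 0 i] in the monomial is 1/2 minus the multiplicity of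
    [i] in [l]; differentiating multiplies by it and divides by [y 0 i]. *)
Lemma is_derive_sqrt_mono l y i : 0 < coord_prod y ->
  is_derive y (delta_mx 0 i : 'rV[R]_4) (sqrt_mono l)
    ((2^-1 - (count_mem i l)%:R) * sqrt_mono (i :: l) y).
Proof.
move=> y_gt0; apply: is_derive_along_line.
have yn0 j := coord_neq0 y j y_gt0.
elim: l => [|j l IHl].
- have -> : (fun h : R => sqrt_mono [::] (h *: delta_mx 0 i + y))
      = (Num.sqrt (coord_prod y)
           \*: (Num.sqrt \o (fun h => h * (y 0 i)^-1 + 1)) : R -> R).
    apply/funext => h /=.
    by rewrite /sqrt_mono big_nil mulr1 coord_prod_line // sqrtrM // ltW.
  have sqrtD : is_derive (0 * (y 0 i)^-1 + 1 : R) 1 Num.sqrt 2^-1.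
    rewrite mul0r add0r.
    by apply: is_derive_eq (is_derive1_sqrt ltr01) _; rewrite sqrtr1 mulr1.
  have := is_deriveZ (Num.sqrt (coord_prod y))
    (@is_derive1_comp _ _ _ 0 _ _ sqrtD (is_derive_affine (y 0 i)^-1 1 0)).
  move=> D; apply: is_derive_eq D _.
  by rewrite /sqrt_mono big_seq1 subr0 /GRing.scale /=; ring.
- have -> : (fun h : R => sqrt_mono (j :: l) (h *: delta_mx 0 i + y))
      = ((fun h : R => sqrt_mono l (h *: delta_mx 0 i + y))
          * (fun h => (h * (j == i)%:R + y 0 j)^-1))%R.
    apply/funext => h.
    by rewrite /sqrt_mono big_cons coord_line [RHS]mulrAC mulrA.
  have linn0 : 0 * (j == i)%:R + y 0 j != 0 :> R by rewrite mul0r add0r.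
  have := is_deriveM IHl
    (@is_deriveV _ (fun h => h * (j == i)%:R + y 0 j) 0 _ _ linn0
      (is_derive_affine (j == i)%:R (y 0 j) 0)).
  move=> D; apply: is_derive_eq D _.
  rewrite mul0r !add0r scale0r add0r /sqrt_mono !big_cons /GRing.scale /=.
  rewrite natrD; have [yi yj] := (yn0 i, yn0 j).
  case: (eqVneq j i) => [ji|_] /=; last by field; rewrite yi yj.
  by subst j; field.
Qed.

(** A derivative depends only on the germ of the function, so it is enough to
    know [f] on the open set where the product of coordinates is positive.
    This makes it possible to differentiate F^2 three times in succession. *)
Lemma derive_sqrt_mono (f : 'rV[R]_4 -> R) a l y i :
  (forall z, 0 < coord_prod z -> f z = a * sqrt_mono l z) ->
  0 < coord_prod y ->
  'D_(delta_mx 0 i) f y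
    = a * (2^-1 - (count_mem i l)%:R) * sqrt_mono (i :: l) y.
Proof.
move=> fE y_gt0.
have -> : 'D_(delta_mx 0 i) f y = 'D_(delta_mx 0 i) (a \*: sqrt_mono l) y.
  apply: near_eq_derive; near=> z; rewrite fE //.
  by near: z; exact: (open_nbhs_nbhs (conj open_coord_prod_gt0 y_gt0)).
have D := is_deriveZ a (is_derive_sqrt_mono l y i y_gt0).
by rewrite (derive_val (is_derive := D)) -mulrA.
Unshelve. all: by end_near.
Qed.

End Monomials.

(** * The Berwald-Moor metric and its Cartan connection *)

Section FundamentalTensor.
Context {R : realType} (h11 : R -> R) (h11_gt0 : forall t, 0 < h11 t).
Implicit Types (t : R) (x y : 'rV[R]_4) (i j k m r : 'I_4).

Local Notation F := (berwald_moor h11).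
Local Notation N := (berwald_moor_N h11).

Lemma berwald_moor_sqr t y : 0 < coord_prod y ->
  F t y ^+ 2 = (h11 t)^-1 * Num.sqrt (coord_prod y).
Proof.
move=> y_gt0; rewrite /berwald_moor -/(coord_prod y) exprMn sqr_sqrtr; last first.
  by rewrite invr_ge0 ltW.
rewrite -powR_mulrn ?powR_ge0 // -powRrM -powR12_sqrt ?ltW //.
by congr (_ * _ `^ _); field.
Qed.

Lemma berwald_moor_gt0 t y : 0 < coord_prod y -> 0 < F t y.
Proof.
by move=> y_gt0; rewrite mulr_gt0 ?powR_gt0 // sqrtr_gt0 invr_gt0.
Qed.

Lemma g_lowE t x y i j : 0 < coord_prod y ->
  g_low h11 F t x y i j = 8^-1 * (1 - 2 * (i == j)%:R) * sqrt_mono [:: i; j] y.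
Proof.
move=> y_gt0; rewrite mxE /jet_partial_y.
rewrite (derive_sqrt_mono _ ((h11 t)^-1 * 2^-1) [:: j]) //; last first.
  move=> z z_gt0; rewrite (derive_sqrt_mono _ (h11 t)^-1 [::]) //.
    by rewrite subr0.
  by move=> w w_gt0; rewrite berwald_moor_sqr // /sqrt_mono big_nil mulr1.
rewrite /= addn0 eq_sym; set d := _%:R; set M := sqrt_mono _ _.
by have := lt0r_neq0 (h11_gt0 t) => h0; field.
Qed.

Lemma partial_g_lowE t x y i j k : 0 < coord_prod y ->
  jet_partial_y k (fun t x y => g_low h11 F t x y i j) t x y =
  8^-1 * (1 - 2 * (i == j)%:R) * (2^-1 - (i == k)%:R - (j == k)%:R)
    * sqrt_mono [:: k; i; j] y.
Proof.
move=> y_gt0; rewrite /jet_partial_y.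
rewrite (derive_sqrt_mono _ (8^-1 * (1 - 2 * (i == j)%:R)) [:: i; j]) //.
  by rewrite /= addn0 natrD opprD addrA.
by move=> z z_gt0; exact: g_lowE.
Qed.

(** The candidate inverse works because the matrix J with entries
    1 - 2 delta_ij satisfies J^2 = 4 on four indices, while the factors in y
    cancel telescopically. *)
Lemma g_upE t x y i j : 0 < coord_prod y ->
  g_up h11 F t x y i j =
  2 * (1 - 2 * (i == j)%:R) * (y 0 i * y 0 j) / Num.sqrt (coord_prod y).
Proof.
move=> y_gt0.
pose B := \matrix_(i, j)
  (2 * (1 - 2 * (i == j)%:R) * (y 0 i * y 0 j) / Num.sqrt (coord_prod y) : R)
   : 'M[R]_4.
suff -> : g_up h11 F t x y = B by rewrite mxE.
have gB : g_low h11 F t x y *m B = 1%:M.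
  apply/matrixP => r m; rewrite !mxE.
  have -> : \sum_j0 g_low h11 F t x y r j0 * B j0 m
     = 4^-1 * (y 0 m / y 0 r)
      * \sum_j0 (1 - 2 * (r == j0)%:R) * (1 - 2 * (j0 == m)%:R).
    rewrite mulr_sumr; apply: eq_bigr => n _.
    rewrite g_lowE // mxE /sqrt_mono !big_cons big_nil.
    have s0 : Num.sqrt (coord_prod y) != 0 by rewrite lt0r_neq0 // sqrtr_gt0.
    have := (coord_neq0 y r y_gt0, coord_neq0 y n y_gt0) => -[yr yn].
    by field; rewrite s0 yr yn.
  have -> : \sum_n (1 - 2 * (r == n)%:R) * (1 - 2 * (n == m)%:R)
      = 4 * (r == m)%:R :> R.
    rewrite !big_ord_recl big_ord0.
    by case: r => [[|[|[|[|r]]]] //= ?]; case: m => [[|[|[|[|m]]]] //= ?];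
       rewrite /eq_op /=; ring.
  case: (eqVneq r m) => [->|]; last by rewrite !mulr0.
  by have := coord_neq0 y m y_gt0 => ym; field.
have [gU _] := mulmx1_unit gB.
by rewrite /g_up -[RHS](mulKmx gU) gB mulmx1.
Qed.

(** The factor h11 cancels the h^11 of F^2: the contravariant metric is
    proportional to the tensor square of the unit direction y/F, entrywise up
    to the constants 1 - 2 delta_ij. Both plasma equations simplify for this
    reason. *)
Lemma h11_g_upE t x y i j : 0 < coord_prod y ->
  h11 t * g_up h11 F t x y i j =
  2 * (1 - 2 * (i == j)%:R) * (y 0 i / F t y) * (y 0 j / F t y).
Proof.
move=> y_gt0; rewrite g_upE //.
have h0 := lt0r_neq0 (h11_gt0 t).
have F0 := lt0r_neq0 (berwald_moor_gt0 t y y_gt0).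
have s0 : Num.sqrt (coord_prod y) != 0 by rewrite lt0r_neq0 // sqrtr_gt0.
have -> : h11 t = Num.sqrt (coord_prod y) / F t y ^+ 2.
  by rewrite berwald_moor_sqr //; field; rewrite h0 s0.
by field; rewrite F0 s0.
Qed.

(** The metric does not depend on x, so only the vertical part of the adapted
    derivative, given by the nonlinear connection, contributes. *)
Lemma delta_x_g_low t x y i j k : 0 < coord_prod y ->
  delta_x N k (fun t x y => g_low h11 F t x y i j) t x y =
  varkappa h11 t / 3
    * jet_partial_y k (fun t x y => g_low h11 F t x y i j) t x y.
Proof.
move=> y_gt0; rewrite /delta_x.
have -> : jet_partial_x k (fun t x y => g_low h11 F t x y i j) t x y = 0.
  rewrite /jet_partial_x -[RHS](derive_cst (g_low h11 F t x y i j) x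
    (delta_mx 0 k : 'rV[R]_4)).
  by congr ('D_ _ _ _); apply/funext => z; rewrite !g_lowE.
rewrite sub0r (bigD1 k) //= big1 ?addr0 => [|m mk]; last first.
  by rewrite mxE (negPf mk) mulr0 mul0r.
by rewrite mxE eqxx mulr1 mulNr opprK.
Qed.

(** The metric is homogeneous of degree 0 in y and its y-derivatives are
    totally symmetric, so by Euler's identity each Christoffel combination of
    vertical derivatives vanishes once contracted twice with y; L^k_rm is
    (varkappa / 3) times such a combination. *)
Lemma cartan_L_contraction0 t x y k : 0 < coord_prod y ->
  \sum_r \sum_m cartan_L h11 F N k r m t x y * y 0 r * y 0 m = 0.
Proof.
move=> y_gt0.
pose dg i j m := jet_partial_y m (fun t x y => g_low h11 F t x y i j) t x y.
have christoffel0 n :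
    \sum_r \sum_m (dg r n m + dg m n r - dg r m n) * (y 0 r * y 0 m) = 0.
  (* Each contracted derivative is sqrt(y1 y2 y3 y4) / y_n times a rational
     constant, so that only a sum of constants over r and m has to vanish. *)
  pose co (a b d : 'I_4) : R :=
    (1 - 2 * (a == b)%:R) * (2^-1 - (a == d)%:R - (b == d)%:R).
  transitivity (8^-1 * (Num.sqrt (coord_prod y) / y 0 n)
    * \sum_r \sum_m (co r n m + co m n r - co r m n)).
    rewrite mulr_sumr; apply: eq_bigr => r _.
    rewrite mulr_sumr; apply: eq_bigr => m _.
    rewrite /dg !partial_g_lowE // /sqrt_mono !big_cons big_nil /co.
    have yn0 i := coord_neq0 y i y_gt0.
    have [yr [ym yn]] := (yn0 r, (yn0 m, yn0 n)).
    by field; rewrite yr ym yn.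
  apply/eqP; rewrite mulf_eq0; apply/orP; right; apply/eqP.
  rewrite /co !big_ord_recl !big_ord0.
  by case: n => [[|[|[|[|n]]]] //= ?]; rewrite /eq_op /=; field.
transitivity (\sum_n g_up h11 F t x y k n / 2 * (varkappa h11 t / 3) *
   \sum_r \sum_m (dg r n m + dg m n r - dg r m n) * (y 0 r * y 0 m)); last first.
  by rewrite big1 // => n _; rewrite christoffel0 mulr0.
under [RHS]eq_bigr do rewrite mulr_sumr.
rewrite [RHS]exchange_big; apply: eq_bigr => r _ /=.
under [RHS]eq_bigr do rewrite mulr_sumr.
rewrite [RHS]exchange_big; apply: eq_bigr => m _ /=.
rewrite /cartan_L !mulr_suml; apply: eq_bigr => n _.
by rewrite !delta_x_g_low // /dg; ring.
Qed.

End FundamentalTensor.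

(** * Curves in natural parameter *)

Section NaturalParameter.
Context {R : realType}.

(** As I is open, [tau (s u) = u] holds near t, where s is continuous; so the
    inverse function theorem makes tau derivable at [s t], with derivative 1/F,
    and the chain rule applies. *)
Lemma velocity_natural_parameter (F : R -> 'rV[R]_4 -> R) (U : set 'rV[R]_4)
    (I : set R) (x : R -> 'rV[R]_4) (s tau : R -> R) (t : R) (k : 'I_4) :
  regular_curve U I x -> natural_parameter F I x s tau -> I t ->
  F t (velocity x t) != 0 ->
  dn_ds 1 x s tau k t = velocity x t 0 k / F t (velocity x t).
Proof.
move=> [I_open _ x_smooth _] s_natural It F0.
have near_I : \forall u \near t, I u by exact: open_nbhs_nbhs.
have ds := (s_natural t It).1.
have dtau : is_derive (s t) 1 tau (F t (velocity x t))^-1.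
  apply: is_derive_inverse ds F0.
  - by near=> u; rewrite (s_natural u _).2 //; near: u.
  - near=> u; apply: differentiable_continuous; apply/derivable1_diffP.
    have Iu : I u by near: u.
    exact: (@ex_derive _ _ _ _ _ _ _ (s_natural u Iu).1).
have dx : is_derive (tau (s t)) 1 (fun u : R => x u 0 k) (velocity x t 0 k).
  rewrite (s_natural t It).2 mxE derive1E; apply: DeriveDef => //.
  by have [_ /(_ 1)[/(_ _ It)]] := x_smooth k 1.
rewrite /dn_ds /derive1n /= derive1E.
exact: (derive_val (is_derive := is_derive1_comp dx dtau)).
Unshelve. all: by end_near.
Qed.

End NaturalParameter.

Theorem mainTheorem1 (R : realType) (c : R) (h11 : R -> R)
    (U : set 'rV[R]_4) (p rho : jetfun R) (H G : jetmx R)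
    (I : set R) (x : R -> 'rV[R]_4) (s tau : R -> R)
    (c_gt0 : 0 < c)
    (h11_gt0 : forall t, 0 < h11 t)
    (h11_smooth : smooth_on [set: R] h11)
    (U_open : open U)
    (p_smooth : jet_smooth U p)
    (rho_smooth : jet_smooth U rho)
    (H_smooth : forall i j, jet_smooth U (fun t x y => H t x y i j))
    (G_smooth : forall i j, jet_smooth U (fun t x y => G t x y i j))
    (H_skew : forall t x y, jet_dom U (t, x, y) -> (H t x y)^T = - H t x y)
    (G_skew : forall t x y, jet_dom U (t, x, y) -> (G t x y)^T = - G t x y)
    (p_rho_neq0 : forall t x y, jet_dom U (t, x, y) ->
       p t x y + rho t x y * c ^+ 2 != 0)
    (lorentz : lorentz_conditions h11 (berwald_moor h11) (berwald_moor_N h11)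
       H G U)
    (x_curve : regular_curve U I x)
    (s_natural : natural_parameter (berwald_moor h11) I x s tau) :
  forall (t : R) (k : 'I_4), I t ->
  let X := x t in
  let Y := velocity x t in
  let w := p t X Y + rho t X Y * c ^+ 2 in
  (horizontal_stream_line h11 c (berwald_moor h11) (berwald_moor_N h11)
     p rho H G x s tau k t
   <->
   dn_ds 2 x s tau k t
   + c ^+ 2 / w *
     \sum_(m < 4) delta_x (berwald_moor_N h11) m p t X Y
       * (1 - 4 * (k == m)%:R) * dn_ds 1 x s tau m t * dn_ds 1 x s tau k t
   = h11 t * c ^+ 2 / w *
     lorentz_force_h h11 (berwald_moor h11) (berwald_moor_N h11) H G k t X Y)
  /\
  (vertical_stream_line h11 (berwald_moor h11) p H G x s tau k t
   <->
   \sum_(m < 4) jet_partial_y m p t X Y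
     * (1 - 4 * (m == k)%:R) * dn_ds 1 x s tau m t * dn_ds 1 x s tau k t
   = h11 t * lorentz_force_v h11 (berwald_moor h11) H G k t X Y).
Proof.
move=> t k It X Y w.
have Y_gt0 : 0 < coord_prod Y by have [_ _ _ /(_ t It)[]] := x_curve.
have F_gt0 := berwald_moor_gt0 h11 h11_gt0 t Y Y_gt0.
set F := berwald_moor h11 in F_gt0 *; set N := berwald_moor_N h11.
pose D m := dn_ds 1 x s tau m t.
have DE m : D m = Y 0 m / F t Y.
  apply: velocity_natural_parameter x_curve s_natural It _.
  exact: lt0r_neq0.
have g_upD i j : h11 t * g_up h11 F t X Y i j
    = 2 * (1 - 2 * (i == j)%:R) * D i * D j.
  by rewrite !DE; exact: h11_g_upE.
have equiv (u v u' v' : R) : u - v = u' - v' -> (u = v <-> u' = v').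
  move=> e; split=> uv; apply/eqP; rewrite -subr_eq0.
    by rewrite -e uv subrr.
  by rewrite e uv subrr.
split; apply: equiv; rewrite -/X -/Y.
- rewrite -/w; set b := c ^+ 2 / w.
  pose A m := delta_x N m p t X Y.
  (* L drops out, and the Kronecker symbol leaves the pressure term r = k. *)
  have pressureE : \sum_r \sum_m
      (cartan_L h11 F N k r m t X Y - b * (k == r)%:R * A m) * D r * D m
      = - (b * \sum_m A m * D m * D k).
    transitivity ((F t Y ^- 2) *
       \sum_r \sum_m cartan_L h11 F N k r m t X Y * Y 0 r * Y 0 m
       - \sum_r (k == r)%:R * (b * \sum_m A m * D m * D r)).
      rewrite mulr_sumr -sumrB; apply: eq_bigr => r _.
      rewrite !mulr_sumr -sumrB; apply: eq_bigr => m _.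
      move: (b) => b0; have F0 := lt0r_neq0 F_gt0.
      by rewrite !DE; field.
    rewrite cartan_L_contraction0 // mulr0 sub0r (bigD1 k) //= eqxx mul1r.
    rewrite [X in - (_ + X)]big1 ?addr0 // => r.
    by rewrite eq_sym => /negPf ->; rewrite mul0r.
  (* Of the factor 2 (1 - 2 delta) = (1 - 4 delta) + 1 produced by h11 g^km,
     the last summand is the one that cancels the pressure term above. *)
  have gradientE : h11 t * c ^+ 2 / w * (\sum_m g_up h11 F t X Y k m * A m)
      = b * (\sum_m A m * (1 - 4 * (k == m)%:R) * D m * D k)
        + b * \sum_m A m * D m * D k.
    rewrite -mulrDr -big_split !mulr_sumr; apply: eq_bigr => m _ /=.
    transitivity (b * (h11 t * g_up h11 F t X Y k m) * A m).
      by rewrite /b; move: (w^-1) => v; ring.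
    by rewrite g_upD; ring.
  rewrite pressureE mulrBr gradientE.
  by move: (h11 t * c ^+ 2 / w) => a; ring.
(* Here 2 (1 - 2 delta) - 1 = 1 - 4 delta, term by term. *)
- congr (_ - _); apply: eq_bigr => m _.
  by rewrite g_upD -/(D m) -/(D k); ring.
Qed.
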